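(* Let $G$ be a finite connected even graph, let $\mathcal{C}$ be a cycle decomposition of $G$, and let $CI(G)$ be the cycle intersection graph of $G$ with respect to $\mathcal{C}$. If $CI(G)$ is a star with $|E(CI(G))|=n$, then $\nabla(G)=n$.
   Context: An even graph is a graph in which every vertex has even degree (multiple edges are allowed). A cycle decomposition of $G$ is a collection of cycles of $G$ whose edge sets partition $E(G)$. The cycle intersection graph $CI(G)$ with respect to $\mathcal{C}$ is the (multi)graph with vertex set $\mathcal{C}$ having, for each pair of distinct cycles $C,C'\in\mathcal{C}$ and each vertex $v\in V(C)\cap V(C')$, one edge joining $C$ and $C'$. A decycling set of $G$ is a set $S\subseteq V(G)$ with $G\setminus S$ acyclic; $\nabla(G)$ is the minimum size of a decycling set. *)

(* Defs.v *)
(* Finite loopless multigraphs in MathComp. *)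
From mathcomp Require Import all_boot.

Set Implicit Arguments.
Unset Strict Implicit.
Unset Printing Implicit Defensive.

(* Parallel edges are distinct elements of [edge G] with the same [ends];
   there are no loops, as an edge has exactly two ends. *)
Record mgraph := MGraph {
  vertex : finType;
  edge : finType;
  ends : edge -> {set vertex};
  card_ends : forall e, #|ends e| = 2 }.

Definition degree (G : mgraph) (v : vertex G) : nat :=
  #|[set e : edge G | v \in ends e]|.

Definition even_graph (G : mgraph) : bool :=
  [forall v : vertex G, ~~ odd (degree v)].

Definition adjacent (G : mgraph) : rel (vertex G) :=
  fun u v => [exists e : edge G, ends e == [set u; v]].

Definition connected_graph (G : mgraph) : bool :=
  (0 < #|vertex G|) &&
  [forall u : vertex G, forall v : vertex G, connect (@adjacent G) u v].

(* A cycle is given by its edge set C, which determines it as a subgraph.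
   With k = #|C|, its distinct vertices are v_0, ..., v_(k-1), its distinct
   edges are e_0, ..., e_(k-1), and e_i joins v_i to v_(i+1 mod k) ([ordS] is
   the cyclic successor).  Two parallel edges form a cycle of length 2. *)
Definition is_cycle (G : mgraph) (C : {set edge G}) : bool :=
  (1 < #|C|) &&
  [exists v : {ffun 'I_#|C| -> vertex G}, exists e : {ffun 'I_#|C| -> edge G},
    [&& injectiveb v, injectiveb e, [set e i | i : 'I_#|C|] == C &
        [forall i, ends (e i) == [set v i; v (ordS i)]]]].

Definition cycle_vertices (G : mgraph) (C : {set edge G}) : {set vertex G} :=
  \bigcup_(e in C) ends e.

Definition cycle_decomposition (G : mgraph) (D : {set {set edge G}}) : bool :=
  partition D [set: edge G] && [forall C in D, is_cycle C].

Section CycleIntersectionGraph.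
Variables (G : mgraph) (D : {set {set edge G}}).

Definition CI_vertex : finType := {C : {set edge G} | C \in D}.

(* An edge is a pair ({C, C'}, v) with C, C' distinct and v a vertex of both. *)
Definition is_CI_edge (p : {set CI_vertex} * vertex G) : bool :=
  (#|p.1| == 2) && [forall C in p.1, p.2 \in cycle_vertices (val C)].

Definition CI_edge : finType :=
  {p : {set CI_vertex} * vertex G | is_CI_edge p}.

Definition CI_ends (p : CI_edge) : {set CI_vertex} := (val p).1.

Lemma card_CI_ends (p : CI_edge) : #|CI_ends p| = 2.
Proof. by case/andP: (valP p) => /eqP. Qed.

Definition CI : mgraph := MGraph card_CI_ends.

End CycleIntersectionGraph.

(* K_(1,m) with m >= 1: a star has no parallel edges, and K_1 is not a star. *)
Definition is_star (H : mgraph) : bool :=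
  (1 < #|vertex H|) &&
  [exists c : vertex H,
    [forall e : edge H, c \in ends e] &&
    [forall v : vertex H,
      (v != c) ==> (#|[set e : edge H | ends e == [set c; v]]| == 1)]].

Section VertexDeletion.
Variables (G : mgraph) (S : {set vertex G}).

Definition del_vertex : finType := {v : vertex G | v \notin S}.

Definition del_edge : finType := {e : edge G | [disjoint ends e & S]}.

Definition del_ends (e : del_edge) : {set del_vertex} :=
  [set v | val v \in ends (val e)].

Lemma card_del_ends (e : del_edge) : #|del_ends e| = 2.
Proof.
rewrite -(card_ends (val e)) -(card_imset _ val_inj); apply: eq_card => u.
apply/imsetP/idP => [[v + ->]|ue]; first by rewrite inE.
have uS : u \notin S by rewrite (disjointFr (valP e) ue).
by exists (Sub u uS); rewrite ?inE SubK.
Qed.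

Definition del_vertices : mgraph := MGraph card_del_ends.

End VertexDeletion.

Definition acyclic (G : mgraph) : bool :=
  [forall C : {set edge G}, ~~ is_cycle C].

Definition decycling (G : mgraph) (S : {set vertex G}) : bool :=
  acyclic (del_vertices S).

Lemma decycling_setT (G : mgraph) : decycling [set: vertex G].
Proof.
apply/forallP => C; apply/negP => /andP[C_gt1 _].
have /card_gt0P[e _] : 0 < #|C| by apply: ltnW.
have /card_gt0P[v _] : 0 < #|ends e| by rewrite card_ends.
by have := valP v; rewrite inE.
Qed.

(* The minimum is over a nonempty family, by [decycling_setT]. *)
Definition nabla (G : mgraph) : nat :=
  #|[arg min_(S < [set: vertex G] | decycling S) #|S|]|.

(* Main.v *)
(* Let S be the set of vertices shared by two cycles of D.  A nonempty edge set
   K avoiding S without vertices of degree 1 meets some C in D, and K :&: C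
   again has no vertex of degree 1, since outside S all the edges at a vertex
   lie on the same cycle of D.  Hence K :&: C = C, although C meets S; so S is
   decycling, and it has at most as many elements as CI(G) has edges.
   Conversely, the leaves of the star are pairwise disjoint cycles, one for each
   edge of CI(G), and a decycling set meets them all. *)
Require Import Defs.
From mathcomp Require Import all_boot.

Set Implicit Arguments.
Unset Strict Implicit.
Unset Printing Implicit Defensive.

Lemma ordS_neq k (i : 'I_k) : 1 < k -> ordS i != i.
Proof.
move=> k_gt1; rewrite -val_eqE /=.
have [i_max|ne] := eqVneq i.+1 k.
  by rewrite i_max modnn eq_sym -lt0n -ltnS i_max.
by rewrite modn_small ?gtn_eqF // ltn_neqAle ne ltn_ord.
Qed.

(** Lets a property closed under [ordS] spread around a whole cycle. *)
Lemma iter_ordS k (i j : 'I_k) : exists m, iter m (@ordS k) i = j.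
Proof.
have iterE m : iter m (@ordS k) i = (i + m) %% k :> nat.
  elim: m => [|m IHm] /=; first by rewrite addn0 modn_small.
  by rewrite IHm addnS -addn1 modnDml addn1.
(* Climb from [i] to [k], which is 0 modulo [k], then on to [j]. *)
exists (k - i + j); apply: val_inj; rewrite /= iterE addnA subnKC 1?ltnW //.
by rewrite modnDl modn_small.
Qed.

(** No vertex has degree 1 in [K]. Asking for a second edge instead of counting makes the property
    easy to transport between graphs. *)
Definition pendantless (G : mgraph) (K : {set edge G}) :=
  forall f x, f \in K -> x \in ends f ->
  exists g, [/\ g \in K, g != f & x \in ends g].

Section Cycles.
Variable G : mgraph.
Implicit Types C K : {set edge G}.

(* Freeing the length from [#|C|] avoids casts between ordinal types. *)
Lemma is_cycleP C :
  reflect (exists k (v : 'I_k -> vertex G) (e : 'I_k -> edge G),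
    [/\ 1 < k, injective v, injective e, C = [set e i | i : 'I_k] &
        forall i, ends (e i) = [set v i; v (ordS i)]])
  (is_cycle C).
Proof.
apply: (iffP andP) => [[C_gt1 /existsP[v /existsP[e]]]|].
  case/and4P=> /injectiveP v_inj /injectiveP e_inj /eqP defC /forallP endsE.
  by exists #|C|, v, e; split=> // i; apply/eqP.
move=> [k [v [e [k_gt1 v_inj e_inj defC endsE]]]].
have defk : #|C| = k by rewrite defC card_imset // card_ord.
rewrite defk; split=> //.
apply/existsP; exists (finfun v); apply/existsP; exists (finfun e).
apply/and4P; split.
- by apply/injectiveP => i j; rewrite !ffunE; apply: v_inj.
- by apply/injectiveP => i j; rewrite !ffunE; apply: e_inj.
- by rewrite defC; apply/eqP; apply: eq_imset => i; rewrite ffunE.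
- by apply/forallP => i; rewrite !ffunE endsE.
Qed.

Lemma cycle_pendantless C : is_cycle C -> pendantless C.
Proof.
case/is_cycleP=> k [v [e [k_gt1 v_inj e_inj -> endsE]]] _ x /imsetP[i _ ->].
rewrite endsE => /set2P[] ->.
  exists (e (ord_pred i)); split; first exact: imset_f.
    by rewrite (inj_eq e_inj) -(inj_eq (@ordS_inj k)) ord_predK eq_sym ordS_neq.
  by rewrite endsE ord_predK set22.
exists (e (ordS i)); split; first exact: imset_f.
  by rewrite (inj_eq e_inj) ordS_neq.
by rewrite endsE set21.
Qed.

(** At [v (ordS i)] the only edges of [C] are [e i] and [e (ordS i)], so membership in [K] passes
    from each edge to the next, all the way round. *)
Lemma pendantless_sub_cycle C K :
  is_cycle C -> K \subset C -> K != set0 -> pendantless K -> K = C.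
Proof.
case/is_cycleP=> k [v [e [k_gt1 v_inj e_inj -> endsE]]] sKC /set0Pn[f fK] Kp.
have eK_S i : e i \in K -> e (ordS i) \in K.
  move=> eK; have [|g [gK g_ne]] := Kp _ (v (ordS i)) eK.
    by rewrite endsE set22.
  have /imsetP[j _ gE] := subsetP sKC _ gK; rewrite {}gE in gK g_ne *.
  rewrite endsE => /set2P[/v_inj->|/v_inj/ordS_inj eq_ij] //.
  by rewrite eq_ij eqxx in g_ne.
have /imsetP[i _ fE] := subsetP sKC _ fK; rewrite {}fE in fK.
apply/eqP; rewrite eqEsubset sKC; apply/subsetP => _ /imsetP[j _ ->].
by have [m <-] := iter_ordS i j; elim: m => //= m; apply: eK_S.
Qed.

End Cycles.

Section Deletion.
Variable G : mgraph.
Implicit Types (C : {set edge G}) (S : {set vertex G}).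

Lemma cycle_neq0 C : is_cycle C -> C != set0.
Proof. by case/andP=> C_gt1 _; rewrite -card_gt0 ltnW. Qed.

Lemma mem_cycle_vertices C f x :
  f \in C -> x \in ends f -> x \in cycle_vertices C.
Proof. by move=> fC xf; apply/bigcupP; exists f. Qed.

Lemma pendantless_del_vertices S (K : {set edge (del_vertices S)}) :
  pendantless K -> @pendantless G (val @: K).
Proof.
move=> Kp _ x /imsetP[f fK ->] xf.
have xS : x \notin S by rewrite (disjointFr (valP f) xf).
have [|g [gK g_ne xg]] := Kp f (Sub x xS) fK; first by rewrite inE SubK.
exists (val g); split; first exact: imset_f.
  by rewrite (inj_eq val_inj).
by move: xg; rewrite inE SubK.
Qed.

(** A cycle of [G] avoiding [S] would survive in [del_vertices S]: its vertices and edges lift to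
    the subtypes. *)
Lemma decycling_meets S C :
  decycling S -> is_cycle C -> exists2 x, x \in S & x \in cycle_vertices C.
Proof.
move=> /forallP dS cycC; apply/exists_inP; apply: contraT => noS.
have CS x f : f \in C -> x \in ends f -> x \notin S.
  move=> fC xf; apply: contra noS => xS.
  by apply/exists_inP; exists x => //; apply: mem_cycle_vertices xf.
case/is_cycleP: cycC => k [v [e [k_gt1 v_inj e_inj defC endsE]]].
have eC i : e i \in C by rewrite defC imset_f.
have vS i : v i \notin S by apply: CS (eC i) _; rewrite endsE set21.
have eS i : [disjoint ends (e i) & S].
  by apply/pred0P => x /=; apply/andP => -[/(CS _ _ (eC i))/negP].
pose v' i : vertex (del_vertices S) := Sub (v i) (vS i).
pose e' i : edge (del_vertices S) := Sub (e i) (eS i).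
case/negP: (dS [set e' i | i : 'I_k]); apply/is_cycleP; exists k, v', e'.
split=> // [i j /(congr1 val) /v_inj //|i j /(congr1 val) /e_inj //|i].
by apply/setP => x; rewrite !inE /= endsE !inE -!val_eqE.
Qed.

End Deletion.

Section Star.
Variables (G : mgraph) (D : {set {set edge G}}).
Hypotheses (cycD : cycle_decomposition D) (starD : is_star (CI D)).

Let cycleD C : C \in D -> is_cycle C.
Proof. by case/andP: cycD => _ /forall_inP; apply. Qed.

(** Written as an image of the edges of [CI D], so that its size is at most their number. *)
Definition shared_vertices : {set vertex G} :=
  [set (val p).2 | p : edge (CI D)].

Lemma CI_edge_exists (C C' : CI_vertex D) x :
  C != C' -> x \in cycle_vertices (val C) -> x \in cycle_vertices (val C') ->
  exists p : edge (CI D), val p = ([set C; C'], x).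
Proof.
move=> neC xC xC'; have pP : is_CI_edge ([set C; C'], x).
  by rewrite /is_CI_edge cards2 neC; apply/forall_inP => _ /set2P[] ->.
by exists (Sub _ pP).
Qed.

Lemma CI_edge_vertex (p : edge (CI D)) C :
  C \in ends p -> (val p).2 \in cycle_vertices (val C).
Proof. by case/andP: (valP p) => _ /forall_inP; apply. Qed.

Lemma star_covered (C : vertex (CI D)) : exists p : edge (CI D), C \in ends p.
Proof.
case/andP: starD => /card_gt1P[A [B [_ _ neAB]]].
case/existsP=> c /andP[_ /forallP leafP].
have leaf_edge B' : B' != c -> exists p : edge (CI D), ends p = [set c; B'].
  move/(implyP (leafP B')) => /eqP card1.
  have /card_gt0P[p] : 0 < #|[set p : edge (CI D) | ends p == [set c; B']]|.
    by rewrite card1.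
  by rewrite inE => /eqP; exists p.
have [->|/leaf_edge[p pE]] := eqVneq C c; last by exists p; rewrite pE set22.
(* For the centre, any leaf will do, and one of [A] and [B] is a leaf. *)
have [Ac|/leaf_edge[p pE]] := eqVneq A c; last by exists p; rewrite pE set21.
rewrite eq_sym Ac in neAB; have [p pE] := leaf_edge B neAB.
by exists p; rewrite pE set21.
Qed.

Lemma decycling_shared_vertices : decycling shared_vertices.
Proof.
apply/forallP => K'; apply/negP => cycK'.
have [/eqP coverD tiD _] := and3P (proj1 (andP cycD)).
pose K : {set edge G} := val @: K'.
have Kp : pendantless K by apply/pendantless_del_vertices/cycle_pendantless.
have KS f x : f \in K -> x \in ends f -> x \notin shared_vertices.
  by case/imsetP=> g _ -> xg; rewrite (disjointFr (valP g) xg).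
have /set0Pn[f' f'K] := cycle_neq0 cycK'.
have fK : val f' \in K by apply: imset_f.
have /bigcupP[C CD fC] : val f' \in cover D by rewrite coverD inE.
have KC : K :&: C = C.
  apply: pendantless_sub_cycle; [exact: cycleD | exact: subsetIr | |].
    by apply/set0Pn; exists (val f'); rewrite inE fK.
  move=> f x /setIP[fK' fC'] xf; have [g [gK g_ne xg]] := Kp f x fK' xf.
  exists g; split=> //; rewrite inE gK /=.
  have /bigcupP[C' CD' gC'] : g \in cover D by rewrite coverD inE.
  (* If [g] lay on another cycle of [D], then [x] would be a shared vertex on an edge of [K]. *)
  have [->//|neC] := eqVneq C C'; case/negP: (KS _ _ gK xg).
  have [||p pE] := @CI_edge_exists (Sub C CD) (Sub C' CD') x neC.
  - exact: mem_cycle_vertices fC' xf.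
  - exact: mem_cycle_vertices gC' xg.
  by apply/imsetP; exists p; rewrite // pE.
(* Now [C] lies inside [K], yet it passes through a shared vertex. *)
have [p pC] := star_covered (Sub C CD).
have /bigcupP[g gC xg] := CI_edge_vertex pC.
rewrite SubK -KC in gC; have /setIP[gK _] := gC.
by case/negP: (KS _ _ gK xg); apply: imset_f.
Qed.

Lemma star_leaf (p : edge (CI D)) c : c \in ends p ->
  exists2 C, C != c & ends p = [set c; C].
Proof.
move=> cp; have /eqP := card_ends p.
case/cards2P=> A [B [neAB pE]]; rewrite pE in cp *.
case/set2P: cp => ->; first by exists B; rewrite 1?eq_sym.
by exists A; rewrite // setUC.
Qed.

(** Each edge of the star is sent by [h] to a vertex of [S] on the leaf cycle at its end; this map
    is injective. *)
Lemma card_decycling_star (S : {set vertex G}) :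
  decycling S -> #|edge (CI D)| <= #|S|.
Proof.
move=> dS; case/andP: starD => _ /existsP[c /andP[/forallP cP /forallP leafP]].
have hit (p : edge (CI D)) : exists x, (x \in S) &&
    [exists C, [&& C != c, ends p == [set c; C] & x \in cycle_vertices (val C)]].
  have [C neC pE] := star_leaf (cP p).
  have [x xS xC] := decycling_meets dS (cycleD (valP C)).
  by exists x; rewrite xS; apply/existsP; exists C; rewrite neC pE eqxx.
pose h p := xchoose (hit p); have hP p := xchooseP (hit p).
rewrite -(@card_imset _ _ h) => [|p q eq_h]; last first.
  have /andP[_ /existsP[A /and3P[neA pE hA]]] := hP p.
  have /andP[_ /existsP[B /and3P[neB qE hB]]] := hP q.
  rewrite -/(h p) in hA; rewrite -/(h q) -eq_h in hB.
  (* Distinct leaves with a common vertex would span an edge of [CI D] missing the centre [c]. *)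
  have [eqAB|neAB] := eqVneq A B; last first.
    have [r rE] := CI_edge_exists neAB hA hB.
    have := cP r; rewrite /= /CI_ends rE => /set2P[] cE.
      by rewrite cE eqxx in neA.
    by rewrite cE eqxx in neB.
  (* With the same leaf, [p] and [q] are parallel, and a star has no parallel edges. *)
  have /cards1P[r rE] := implyP (leafP A) neA.
  have : p \in [set r] by rewrite -rE inE.
  have : q \in [set r] by rewrite -rE inE eqAB.
  by rewrite !inE => /eqP-> /eqP->.
apply/subset_leq_card/subsetP => _ /imsetP[p _ ->].
by have /andP[] := hP p.
Qed.

End Star.

Theorem theorem4 (G : mgraph) (D : {set {set edge G}}) (n : nat) :
  connected_graph G -> even_graph G -> cycle_decomposition D ->
  is_star (CI D) -> #|edge (CI D)| = n ->
  nabla G = n.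
Proof.
move=> _ _ cycD starD <-; rewrite /nabla.
case: arg_minnP => [|S dS minS]; first exact: decycling_setT.
apply/eqP; rewrite eqn_leq card_decycling_star // andbT.
apply: leq_trans (minS _ (decycling_shared_vertices cycD starD)) _.
exact: leq_imset_card.
Qed.
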